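(* Let $\alpha\in\mathbf{R}$, $\sigma>0$ and $c>0$. Every right-truncated $(\alpha,\sigma)$-lognormal distribution, truncated at $c$, is not infinitely divisible.
   Context: The $(\alpha,\sigma)$-lognormal distribution is the probability measure $\mu_{\alpha,\sigma}$ on $\mathbf{R}_+$ with density $\frac{1}{\sqrt{2\pi\sigma^2}\,y}\exp\{-\frac{(\log y-\alpha)^2}{2\sigma^2}\}$, $y>0$. The right-truncated lognormal is constructed by truncating the interval $[c,+\infty)$, for some $c>0$, and redistributing the removed mass over $[0,c)$: it is a probability measure on $[0,c)$ of the form $\mu_{\alpha,\sigma}|_{(0,c)}+\rho$, where $\rho$ is a non-negative measure on $[0,c)$ of total mass $\mu_{\alpha,\sigma}([c,\infty))$. A probability measure is infinitely divisible if for every integer $n\ge 1$ it is the $n$-fold convolution of some probability measure. *)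

(* Defs.v *)
From HB Require Import structures.
From mathcomp Require Import all_boot all_order all_algebra.
From mathcomp Require Import all_classical all_reals all_analysis.
From mathcomp Require Import measurable_realfun.

Set Implicit Arguments.
Unset Strict Implicit.
Unset Printing Implicit Defensive.

Import Order.TTheory GRing.Theory Num.Theory.
Import numFieldNormedType.Exports.

Local Open Scope classical_set_scope.
Local Open Scope ring_scope.

Section lognormal.
Context {R : realType}.
Implicit Types alpha sigma y : R.

Definition lognormal_pdf alpha sigma y : R :=
  if 0 < y then
    (Num.sqrt (2 * pi * sigma ^+ 2) * y)^-1 *
    expR (- ((ln y - alpha) ^+ 2 / (2 * sigma ^+ 2)))
  else 0.

Lemma lognormal_pdf_ge0 alpha sigma y : 0 <= lognormal_pdf alpha sigma y.
Proof.
rewrite /lognormal_pdf; case: ifPn => // y0.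
by rewrite mulr_ge0 ?expR_ge0// invr_ge0 mulr_ge0 ?sqrtr_ge0// ltW.
Qed.

Lemma measurable_lognormal_pdf alpha sigma :
  measurable_fun [set: R] (lognormal_pdf alpha sigma).
Proof.
have -> : lognormal_pdf alpha sigma = fun y => if 0 < y then
    (Num.sqrt (2 * pi * sigma ^+ 2))^-1 * expR (- ln y) *
    expR (- ((ln y - alpha) ^+ 2 * (2 * sigma ^+ 2)^-1)) else 0.
  apply/funext => y; rewrite /lognormal_pdf; case: ifPn => // y0.
  by rewrite (expRN (ln y)) lnK ?posrE// -invfM.
apply: measurable_fun_ifT => //=; first exact: measurable_fun_ltr.
apply: measurable_funM.
  apply: measurable_funM => //; apply: measurableT_comp => //.
  by apply: measurableT_comp => //; exact: measurable_ln.
apply: measurableT_comp => //; apply: measurableT_comp => //.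
apply: measurable_funM => //; apply: measurable_funX.
by apply: measurable_funB => //; exact: measurable_ln.
Qed.

Definition lognormal alpha sigma (A : set (measurableTypeR R)) : \bar R :=
  (\int[lebesgue_measure]_(y in A) (lognormal_pdf alpha sigma y)%:E)%E.

Section measure.
Variables alpha sigma : R.

Let lognormal0 : lognormal alpha sigma set0 = 0%E.
Proof. by rewrite /lognormal integral_set0. Qed.

Let lognormal_ge0 A : (0 <= lognormal alpha sigma A)%E.
Proof.
by rewrite /lognormal integral_ge0// => y _; rewrite lee_fin lognormal_pdf_ge0.
Qed.

Let lognormal_sigma_additive : semi_sigma_additive (lognormal alpha sigma).
Proof.
move=> F mF tF mUF; rewrite /lognormal ge0_integral_bigcup//=; last 2 first.
- apply/measurable_EFinP/measurable_funTS; exact: measurable_lognormal_pdf.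
- by move=> y _; rewrite lee_fin lognormal_pdf_ge0.
apply: is_cvg_ereal_nneg_natsum_cond => n _ _.
by rewrite integral_ge0// => y _; rewrite lee_fin lognormal_pdf_ge0.
Qed.

HB.instance Definition _ := isMeasure.Build _ _ _ (lognormal alpha sigma)
  lognormal0 lognormal_ge0 lognormal_sigma_additive.

End measure.

End lognormal.

Section convolution.
Context {R : realType}.
Local Notation RT := (measurableTypeR R).

Definition add_pair (xy : RT * RT) : RT := xy.1 + xy.2.

Lemma measurable_add_pair : measurable_fun [set: RT * RT] add_pair.
Proof. by apply: measurable_funD. Qed.

HB.instance Definition _ :=
  isMeasurableFun.Build _ _ (RT * RT)%type RT add_pair measurable_add_pair.

Section def.
Variables P Q : probability RT R.

Definition convolution : set RT -> \bar R :=
  pushforward (P \x Q)%E add_pair.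

Let convolution0 : convolution set0 = 0%E.
Proof. exact: measure0. Qed.

Let convolution_ge0 A : (0 <= convolution A)%E.
Proof. exact: measure_ge0. Qed.

Let convolution_sigma_additive : semi_sigma_additive convolution.
Proof. exact: measure_semi_sigma_additive. Qed.

HB.instance Definition _ := isMeasure.Build _ _ _ convolution
  convolution0 convolution_ge0 convolution_sigma_additive.

Let convolution_setT : convolution [set: RT] = 1%E.
Proof.
rewrite /convolution /pushforward preimage_setT -setXTT product_measure1E//.
by rewrite [X in (X * _)%E]probability_setT [X in (_ * X)%E]probability_setT mule1.
Qed.

HB.instance Definition _ :=
  Measure_isProbability.Build _ _ _ convolution convolution_setT.

End def.

Implicit Types P Q : probability RT R.

(* The value at n = 0 is the neutral element of convolution. *)
Definition convolution_power (n : nat) (Q : probability RT R)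
    : probability RT R :=
  iterop n (fun P1 P2 => convolution P1 P2 : probability RT R) Q
    (dirac (0 : RT) : probability RT R).

(* Library measures are functions on all sets, constrained only on measurable
   ones; equality of measures is therefore equality on measurable sets. *)
Definition infinitely_divisible P : Prop :=
  forall n : nat, (1 <= n)%N ->
    exists Q : probability RT R,
      forall A : set RT, measurable A -> P A = convolution_power n Q A.

(* A measure on [0, c) is encoded as a Borel measure on the line that vanishes
   on the complement of [0, c). *)
Definition right_truncated_lognormal (alpha sigma c : R) P : Prop :=
  exists rho : {measure set RT -> \bar R},
    [/\ rho (~` `[0, c[%classic) = 0%E,
        rho [set: RT] = lognormal alpha sigma `[c, +oo[%classic &
        forall A : set RT, measurable A ->
          P A = (lognormal alpha sigma (A `&` `]0%R, c[%classic) + rho A)%E].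

End convolution.

(* Main.v *)
Require Import Defs.
From HB Require Import structures.
From mathcomp Require Import all_boot all_order all_algebra.
From mathcomp Require Import all_classical all_reals all_analysis.
From mathcomp Require Import measurable_realfun ring lra.

Set Implicit Arguments.
Unset Strict Implicit.
Unset Printing Implicit Defensive.

Import Order.TTheory GRing.Theory Num.Theory.

Local Open Scope ring_scope.

(** A truncated lognormal law P is carried by [0, c). If P is the n-fold
    convolution of Q, then Q is carried by [0, c / n), since a Q-charged
    half-line would force P to charge its n-fold sumset. Let M(s) be the
    integral of exp(s x). On [0, c / n) the variance of exp(x) under Q is
    O(1 / n^2), and M is multiplicative under convolution, so
    M_P(2) <= M_P(1)^2 (1 + O(1 / n^2))^n. Letting n tend to infinity, exp(x)
    has zero variance under P, so P is a Dirac mass, which contradicts the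
    positive lognormal density on (0, c). *)

Section infinite_divisibility.
Context {R : realType}.
Local Notation RT := (measurableTypeR R).
Local Open Scope classical_set_scope.
Implicit Types P Q : probability RT R.

(** * Positivity of convolutions on sumsets *)

Lemma convolution_gt0 P Q (A B C : set RT) :
  measurable A -> measurable B -> measurable C ->
  (forall x y, A x -> B y -> C (x + y)) ->
  (0 < P A)%E -> (0 < Q B)%E -> (0 < convolution P Q C)%E.
Proof.
move=> mA mB mC ABC PA QB; have PQ : (0 < (P \x Q) (A `*` B))%E.
  by rewrite product_measure1E// mule_gt0.
apply: (lt_le_trans PQ); apply: le_measure; rewrite ?inE.
- exact: measurableX.
- by rewrite -[X in measurable X]setTI; exact: measurable_add_pair.
- by case=> x y /= [? ?]; exact: ABC.
Qed.

Lemma convolution_powerS n Q :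
  convolution_power n.+2 Q =
  (convolution Q (convolution_power n.+1 Q) : probability RT R).
Proof. by []. Qed.

(** Induction on [n] with [convolution_gt0]. The set [C k] receives sums of [k.+1] independent draws
    that all lie in [C 0], hence the index shift. *)
Lemma convolution_power_gt0 Q (C : nat -> set RT) n :
  (forall k, measurable (C k)) ->
  (forall k x y, C 0%N x -> C k y -> C k.+1 (x + y)) ->
  (0 < Q (C 0%N))%E -> (0 < convolution_power n.+1 Q (C n))%E.
Proof.
move=> mC CD QC; elim: n => [//|n IH].
apply: (@convolution_gt0 Q (convolution_power n.+1 Q) (C 0%N) (C n)) => //.
exact: CD.
Qed.

(** * Exponential moments *)

Definition exp_moment P (s : R) : \bar R := (\int[P]_x (expR (s * x))%:E)%E.

Lemma measurable_exp_lin (s : R) :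
  measurable_fun [set: RT] (fun x : RT => (expR (s * x))%:E).
Proof.
by apply/measurable_EFinP; apply: measurableT_comp.
Qed.

(** Tonelli applied to exp(s(x + y)) = exp(s x) exp(s y); nonnegativity allows infinite values on
    both sides. *)
Lemma exp_moment_convolution P Q s :
  exp_moment (convolution P Q) s = (exp_moment P s * exp_moment Q s)%E.
Proof.
have mE := measurable_exp_lin s.
have E0 (x : RT) : (0 <= (expR (s * x))%:E)%E by rewrite lee_fin expR_ge0.
rewrite /exp_moment ge0_integral_pushforward//= preimage_setT.
rewrite fubini_tonelli1//=; last first.
  by apply: (measurableT_comp mE); exact: measurable_add_pair.
rewrite -ge0_integralZr//; last exact: integral_ge0.
apply: eq_integral => x _; rewrite -ge0_integralZl//.
by apply: eq_integral => y _; rewrite /= /add_pair /= mulrDr expRD EFinM.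
Qed.

Lemma exp_moment_power Q s (m : R) n :
  exp_moment Q s = m%:E ->
  exp_moment (convolution_power n.+1 Q) s = (m ^+ n.+1)%:E.
Proof.
move=> Qm; elim: n => [|n IH]; first by rewrite expr1.
by rewrite convolution_powerS exp_moment_convolution Qm IH -EFinM -exprS.
Qed.

Lemma integral_null_setC Q (D : set RT) (f : RT -> \bar R) :
  measurable D -> measurable_fun [set: RT] f -> (forall x, 0 <= f x)%E ->
  Q (~` D) = 0%E -> (\int[Q]_x f x = \int[Q]_(x in D) f x)%E.
Proof.
move=> mD mf f0 QD; have mDC := measurableC mD.
by rewrite (ge0_negligible_integral mDC _ _ _ QD)// setTD setCK.
Qed.

(** A reverse Cauchy-Schwarz inequality: exp x is confined to [1, exp b] almost surely. The error is
    relative to m^2, a form that survives taking powers when moments multiply under convolution. *)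
Lemma bounded_exp_moments Q (b : R) :
  0 <= b -> Q (~` `[0, b[) = 0%E ->
  exists m a : R, [/\ exp_moment Q 1 = m%:E, exp_moment Q 2 = a%:E,
    0 <= a & a <= m ^+ 2 * (1 + (expR b - 1) ^+ 2)].
Proof.
set D : set RT := `[0, b[%classic => b0 QD.
have mD : measurable (D : set RT) by exact: measurable_itv.
have QD1 : Q D = 1%E.
  by rewrite -[D]setCK probability_setC ?QD ?sube0//; exact: measurableC.
have Icst (r : R) : (\int[Q]_(x in D) r%:E = r%:E)%E.
  by rewrite integral_cst// [X in (_ * X)%E]QD1 mule1.
have E s : exp_moment Q s = (\int[Q]_(x in D) (expR (s * x))%:E)%E.
  by apply: integral_null_setC => //; exact: measurable_exp_lin.
have ge0 s (x : RT) : D x -> (0 <= (expR (s * x))%:E)%E.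
  by rewrite lee_fin expR_ge0.
have mexp s : measurable_fun D (fun x : RT => (expR (s * x))%:E).
  by apply: measurable_funTS; exact: measurable_exp_lin.
have fin s : 0 <= s -> exp_moment Q s \is a fin_num.
  move=> s0; rewrite ge0_fin_numE; last first.
    by apply: integral_ge0 => x _; rewrite lee_fin expR_ge0.
  apply: (@le_lt_trans _ _ (\int[Q]_(x in D) (expR (s * b))%:E)%E).
    rewrite E; apply: ge0_le_integral => //.
    move=> x; rewrite /D/= in_itv/= => /andP[_ xb].
    by rewrite lee_fin ler_expR ler_wpM2l// ltW.
  by rewrite Icst ltry.
have [m Em] : exists m, exp_moment Q 1 = m%:E by apply/EFin_fin_numP/fin.
have [a Ea] : exists a, exp_moment Q 2 = a%:E by apply/EFin_fin_numP/fin.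
exists m, a; split => //.
  by rewrite -lee_fin -Ea; apply: integral_ge0 => x _; rewrite lee_fin expR_ge0.
set d := expR b - 1.
have d0 : 0 <= d by rewrite subr_ge0 -[leLHS]expR0 ler_expR.
(* Integrate (exp x - 1) (1 + d - exp x) >= 0. *)
have amd : a + (1 + d) <= (2 + d) * m.
  rewrite -lee_fin EFinD EFinM -Ea -Em !E.
  have -> : (1 + d)%:E = (\int[Q]_(x in D) (1 + d)%:E)%E by rewrite Icst.
  rewrite -ge0_integralD//; last by move=> x _; rewrite lee_fin; lra.
  rewrite -ge0_integralZl//; last by rewrite lee_fin; lra.
  apply: ge0_le_integral => //.
  - by move=> x Dx; rewrite adde_ge0// ?ge0// lee_fin; lra.
  - by apply: emeasurable_funD.
  - exact: measurable_funeM.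
  move=> x; rewrite /D/= in_itv/= => /andP[x0 /ltW xb].
  rewrite -EFinD -EFinM lee_fin mul1r expRM_natl.
  have e1 : 1 <= expR x by rewrite -[leLHS]expR0 ler_expR.
  have ed : expR x <= 1 + d by rewrite /d subrKC ler_expR.
  have -> : (2 + d) * expR x = expR x ^+ 2 + (1 + d) +
      (expR x - 1) * (1 + d - expR x) by ring.
  by rewrite lerDl mulr_ge0 ?subr_ge0.
(* The discriminant in m of m^2 (1 + d^2) - (2 + d) m + (1 + d) is
   - d^2 (3 + 4 d) <= 0. *)
rewrite -(@ler_pM2l _ (4 * (1 + d ^+ 2))); last first.
  by rewrite mulr_gt0// ltr_pwDl// sqr_ge0.
have : 0 <= (2 * (1 + d ^+ 2) * m - (2 + d)) ^+ 2 + d ^+ 2 * (3 + 4 * d).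
  by rewrite addr_ge0 ?sqr_ge0// mulr_ge0 ?sqr_ge0//; lra.
have : 0 <= (4 * (1 + d ^+ 2)) * ((2 + d) * m - (a + (1 + d))).
  by rewrite mulr_ge0 ?subr_ge0// mulr_ge0// addr_ge0// sqr_ge0.
lra.
Qed.

(** * Infinitely divisible laws of bounded support *)

Lemma infinitely_divisible_support P (c : R) n :
  infinitely_divisible P -> P (~` `[0, c[) = 0%E ->
  exists Q, [/\ (forall A, measurable A -> P A = convolution_power n.+1 Q A) &
     Q (~` `[0, c / n.+1%:R[) = 0%E].
Proof.
move=> idP Pc; have [Q PE] := idP n.+1 isT; exists Q; split => //.
have n0 : n.+1%:R != 0 :> R by rewrite pnatr_eq0.
have mc : measurable (~` `[0, c[%classic : set RT).
  by apply: measurableC; exact: measurable_itv.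
(* Half-lines reached by sums of [k.+1] draws from [L 0] or from [U 0]. At [k = n] the threshold of
   [U] is exactly [c], so [L n] and [U n] both miss [0, c), where P lives. *)
pose L (k : nat) : set RT := `]-oo, 0[%classic.
pose U (k : nat) : set RT := `[(c / n.+1%:R) *+ k.+1, +oo[%classic.
have mL k : measurable (L k) by exact: measurable_itv.
have mU k : measurable (U k) by exact: measurable_itv.
have null (C : nat -> set RT) : (forall k, measurable (C k)) ->
    (forall k (x y : RT), C 0%N x -> C k y -> C k.+1 (x + y)) ->
    C n `<=` ~` `[0, c[ -> Q (C 0%N) = 0%E.
  move=> mC CD Cn; apply/eqP; rewrite -measure_le0 leNgt; apply/negP => QC.
  have := convolution_power_gt0 n mC CD QC.
  by rewrite -PE// (@subset_measure0 _ _ _ P _ (~` `[0, c[)) ?ltxx.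
have QL : Q (L 0%N) = 0%E.
  apply: null => //.
  - by move=> k x y; rewrite /L/= !in_itv/=; lra.
  - by move=> x; rewrite /L/= !in_itv/= => x0 /andP[]; lra.
have QU : Q (U 0%N) = 0%E.
  apply: null => //.
  - move=> k x y; rewrite /U/= !in_itv/= !andbT.
    by rewrite (mulrS _ k.+1) mulr1n; exact: lerD.
  - move=> x; rewrite /U/= !in_itv/= andbT -mulr_natr divfK// => cx /andP[_].
    by rewrite ltNge cx.
apply: (@subset_measure0 _ _ _ Q _ (L 0%N `|` U 0%N)).
- by apply: measurableC; exact: measurable_itv.
- exact: measurableU.
- move=> x; rewrite /L /U/= !in_itv/= andbT mulr1n => /negP.
  by rewrite negb_and -ltNge -leNgt => /orP.
- by rewrite -[RHS]QL; apply: measureU0.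
Qed.

(** Cauchy-Schwarz gives the opposite inequality, so this forces exp x to have zero variance under
    [P]. *)
Lemma infinitely_divisible_exp_moments P (c : R) :
  infinitely_divisible P -> 0 <= c -> P (~` `[0, c[) = 0%E ->
  exists m a : R, [/\ exp_moment P 1 = m%:E, exp_moment P 2 = a%:E &
    a <= m ^+ 2].
Proof.
move=> idP c0 Pc; have [m [a [Em Ea a0 _]]] := bounded_exp_moments c0 Pc.
exists m, a; split => //; rewrite leNgt; apply/negP => ma.
(* Chosen so that exp(c / n) - 1 <= K / n for every n >= 1: use exp t - 1 <= t exp t and exp t <=
   exp c at t = c / n. *)
pose K := c * expR c.
(* The [n.+1]-st power of the bound for one factor costs exp(u) with u = K^2 / (n + 1); moving it to
   the left and using 1 - u <= exp(-u) leaves an error linear in u. *)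
have bound n : a * (1 - K ^+ 2 / n.+1%:R) <= m ^+ 2.
  have n0 : 0 < n.+1%:R :> R by rewrite ltr0n.
  have [Q [PE Qc]] := infinitely_divisible_support n idP Pc.
  have b0 : 0 <= c / n.+1%:R by rewrite divr_ge0// ltW.
  have [mq [aq [Emq Eaq aq0]]] := bounded_exp_moments b0 Qc.
  set d := expR _ - 1 => aqm.
  have PQ s : exp_moment P s = exp_moment (convolution_power n.+1 Q) s.
    by apply: eq_measure_integral => A mA _; exact: PE.
  move: Em Ea; rewrite !PQ (exp_moment_power _ Emq) (exp_moment_power _ Eaq).
  move=> [<-] [<-].
  have d0 : 0 <= d by rewrite subr_ge0 -[leLHS]expR0 ler_expR.
  have dK : d <= K / n.+1%:R.
    have : 1 - c / n.+1%:R <= expR (- (c / n.+1%:R)) by exact: expR_ge1Dx.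
    rewrite -(ler_pM2l (expR_gt0 (c / n.+1%:R))) -expRD subrr expR0 => h.
    apply: (@le_trans _ _ (c / n.+1%:R * expR (c / n.+1%:R))).
      rewrite /d lerBlDl -lerBlDr [X in _ - X]mulrC -{1}[expR _]mulr1.
      by rewrite -mulrBr.
    rewrite /K mulrAC ler_wpM2r ?invr_ge0 ?(ltW n0)//.
    rewrite ler_wpM2l// ler_expR ler_pdivrMr// ler_peMr//.
    by rewrite ler1n.
  (* The exponent is written as two divisions because raising to the power [n.+1] cancels one of
     them. *)
  have d2 : 1 + d ^+ 2 <= expR (K ^+ 2 / n.+1%:R / n.+1%:R).
    apply: le_trans (expR_ge1Dx _); rewrite lerD2l.
    rewrite (_ : _ / _ / _ = (K / n.+1%:R) ^+ 2); last first.
      by rewrite expr_div_n -mulrA -invfM -expr2.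
    by rewrite ler_sqr// nnegrE ?(le_trans d0 dK).
  have aqe : aq <= mq ^+ 2 * expR (K ^+ 2 / n.+1%:R / n.+1%:R).
    by apply: (le_trans aqm); rewrite ler_wpM2l// sqr_ge0.
  have aqn : aq ^+ n.+1 <= (mq ^+ n.+1) ^+ 2 * expR (K ^+ 2 / n.+1%:R).
    rewrite -exprM mulnC exprM -[X in expR X](divfK (lt0r_neq0 n0)).
    by rewrite expRM_natr -exprMn lerXn2r// nnegrE mulr_ge0 ?sqr_ge0// expR_ge0.
  apply: (@le_trans _ _ (aq ^+ n.+1 * expR (- (K ^+ 2 / n.+1%:R)))).
    by rewrite ler_wpM2l ?exprn_ge0// expR_ge1Dx.
  by rewrite expRN ler_pdivrMr ?expR_gt0.
have am : 0 < a - m ^+ 2 by rewrite subr_gt0.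
(* For such [n] the error a K^2 / (n + 1) is smaller than the assumed gap a - m^2, contradicting
   [bound]. *)
have [n] : exists n : nat, a * K ^+ 2 / (a - m ^+ 2) < n%:R.
  exists (Num.bound (a * K ^+ 2 / (a - m ^+ 2))).
  by rewrite archi_boundP// divr_ge0 ?(ltW am)// mulr_ge0// sqr_ge0.
rewrite ltr_pdivrMr// => nK.
have := bound n; apply/negP; rewrite -ltNge.
have n1 : 0 < n.+1%:R :> R by rewrite ltr0n.
have : a * (K ^+ 2 / n.+1%:R) < a - m ^+ 2.
  rewrite mulrA ltr_pdivrMr// [ltRHS]mulrC (lt_le_trans nK)//.
  by rewrite ler_wpM2r ?(ltW am)// ler_nat.
by rewrite mulrBr mulr1 ltrBrDl -ltrBrDr.
Qed.

Lemma infinitely_divisible_bounded P (c : R) :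
  infinitely_divisible P -> 0 <= c -> P (~` `[0, c[) = 0%E ->
  exists x : R, P (~` [set x]) = 0%E.
Proof.
move=> idP c0 Pc.
have [m [a [Em Ea am]]] := infinitely_divisible_exp_moments idP c0 Pc.
have m0 : 0 <= m.
  by rewrite -lee_fin -Em; apply: integral_ge0 => x _; rewrite lee_fin expR_ge0.
(* The integral of (exp x - m)^2 equals a - m^2 <= 0, so exp x = m almost surely. *)
exists (ln m).
pose g (x : RT) : \bar R := ((expR x - m) ^+ 2)%:E.
have mg : measurable_fun [set: RT] g.
  by apply/measurable_EFinP; apply: measurable_funX; apply: measurable_funB.
have g0 x : (0 <= g x)%E by rewrite lee_fin sqr_ge0.
have e0 s (x : RT) : (0 <= (expR (s * x))%:E)%E by rewrite lee_fin expR_ge0.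
have Ig0 : (\int[P]_x g x = 0)%E.
  apply/eqP; rewrite eq_le integral_ge0// andbT.
  (* The square is expanded with its cross term on the left, so that every integrand is nonnegative
     and no extended reals are subtracted. *)
  have : (\int[P]_x g x + (2 * m)%:E * exp_moment P 1 =
          exp_moment P 2 + (m ^+ 2)%:E)%E.
    rewrite /exp_moment -ge0_integralZl//; last 2 first.
    - exact: measurable_exp_lin.
    - by rewrite lee_fin mulr_ge0.
    have -> : (m ^+ 2)%:E = (\int[P]_x (m ^+ 2)%:E)%E.
      by rewrite integral_cst// [X in (_ * X)%E]probability_setT mule1.
    rewrite -ge0_integralD//; last 2 first.
    - by move=> x _; rewrite mule_ge0// lee_fin mulr_ge0.
    - by apply: measurable_funeM; exact: measurable_exp_lin.
    rewrite -ge0_integralD//; last 2 first.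
    - exact: measurable_exp_lin.
    - by move=> x _; rewrite lee_fin sqr_ge0.
    apply: eq_integral => x _; rewrite /g -EFinM -!EFinD mul1r expRM_natl.
    by congr EFin; ring.
  rewrite Em Ea -EFinM -EFinD; case: (\int[P]_x g x)%E => //= r [] h.
  by rewrite lee_fin; lra.
have mx : measurable (~` [set ln m] : set RT) by exact: measurableC.
apply/(negligibleP _ mx).
have : ae_eq P setT g (cst 0%E).
  by apply/ae_eq_integral_abs => //; under eq_integral do rewrite gee0_abs//.
apply: negligibleS => x /= xm; apply: contra_not xm => /(_ I) [].
by move=> /eqP; rewrite sqrf_eq0 subr_eq0 => /eqP <-; rewrite expRK.
Qed.

(** * The lognormal law is not concentrated at a point *)

(** By contraposition: a nonnegative density with zero integral vanishes almost everywhere on [A],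
    but this one is strictly positive there, so [A] is Lebesgue-null. *)
Lemma lognormal_gt0 (alpha sigma : R) (A : set RT) :
  0 < sigma -> measurable A -> A `<=` `]0, +oo[ ->
  (0 < lebesgue_measure A)%E -> (0 < lognormal alpha sigma A)%E.
Proof.
move=> s0 mA A0; apply: contraTT; rewrite -!leNgt !measure_le0 => /eqP LA.
apply/eqP/(negligibleP _ mA).
have mf : measurable_fun A (fun y : RT => (lognormal_pdf alpha sigma y)%:E).
  by apply/measurable_EFinP/measurable_funTS; exact: measurable_lognormal_pdf.
have : ae_eq lebesgue_measure A
    (fun y => (lognormal_pdf alpha sigma y)%:E) (cst 0%E).
  apply/ae_eq_integral_abs => //; rewrite -[RHS]LA.
  by apply: eq_integral => y _; rewrite gee0_abs// lee_fin lognormal_pdf_ge0.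
apply: negligibleS => y Ay /= /(_ Ay) [].
have := A0 _ Ay; rewrite /= in_itv/= andbT /lognormal_pdf => y0; rewrite y0.
apply/eqP; rewrite gt_eqF// mulr_gt0 ?expR_gt0// invr_gt0 mulr_gt0// sqrtr_gt0.
by rewrite !mulr_gt0 ?pi_gt0// exprn_gt0.
Qed.

End infinite_divisibility.

Theorem proposition1p3 (R : realType) (alpha sigma c : R)
    (P : probability (measurableTypeR R) R) :
  0 < sigma -> 0 < c ->
  right_truncated_lognormal alpha sigma c P ->
  ~ infinitely_divisible P.
Proof.
move=> s0 c0 [rho [rho0 _ PE]] idP.
have mI : measurable (~` `[0, c[%classic : set (measurableTypeR R)).
  by apply: measurableC.
have Pc : P (~` `[0, c[)%classic = 0%E.
  rewrite PE// [X in (_ + X)%E]rho0 adde0.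
  rewrite (_ : _ `&` _ = set0)%classic ?measure0//.
  apply/seteqP; split => x //= [+ xc]; apply.
  by move: xc; rewrite /= !in_itv/= => /andP[/ltW -> ->].
have [x Px] := infinitely_divisible_bounded idP (ltW c0) Pc.
have mx : measurable (~` [set x] : set (measurableTypeR R))%classic.
  by apply: measurableC.
have : (0 < P (~` [set x])%classic)%E; last by rewrite Px ltxx.
rewrite PE//; apply: lt_le_trans (leeDl _ (measure_ge0 rho _)).
apply: lognormal_gt0 => //.
- exact: measurableI.
- by move=> y [_] /=; rewrite !in_itv/= => /andP[->].
(* Adding the null set {x} back gives a set that contains (0, c), whose length is c > 0. *)
have -> : lebesgue_measure (~` [set x] `&` `]0, c[)%classic =
          lebesgue_measure (~` [set x] `&` `]0, c[ `|` [set x])%classic.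
  apply/esym/measureU0 => //; first exact: measurableI.
  exact: lebesgue_measure_set1.
apply: (@lt_le_trans _ _ (lebesgue_measure (`]0, c[ : set R)%classic)).
  by rewrite lebesgue_measure_itv/= lte_fin c0 -EFinB subr0 lte_fin.
apply: le_measure; rewrite ?inE//.
  by apply: measurableU => //; exact: measurableI.
by move=> y yc; have [->|/eqP yx] := eqVneq y x; [right|left].
Qed.
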